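(* Let $G$ be a signed graph, $\beta\in(0,1]$ a tolerance parameter, and $0<\epsilon<1$. For each $x\in V(G)$ let $G_x$ and $\mathcal{X}_x$ be the subgraph and coloring found by the algorithm $\mathtt{Search}$ (described in the context) started from vertex $x$, and let $G_{opt}$ be the optimal graph among all $G_x$, $x\in V(G)$, i.e. one with the largest value $\hat\Phi(G_x,\beta,\mathcal{X}_x)$. Assume that the following two hypotheses hold. (Hypothesis A) There exists a subset $V'\subseteq V(G_{opt})$ with $\frac{|V'|}{|V(G_{opt})|}\ge\frac12$ such that $\Phi(G_x,\beta)\ge(1-\epsilon)\,\Phi(G_{opt},\beta)$ for all $x\in V'$. (Hypothesis B) For all $a,b\in V(G)$, if $\hat\Phi(G_a,\beta,\mathcal{X}_a)\ge\hat\Phi(G_b,\beta,\mathcal{X}_b)$, then $|V(G_b)|\le 2|V(G_a)|$. Run $\mathtt{Search}$ in $k$ iterations, where the $i$-th iteration starts with an independently and uniformly sampled vertex $x_i\in V(G)$, and let $G_i=G_{x_i}$ be the subgraph found in the $i$-th iteration. Let $X$ be the number of iterations $i$ that find a $(1-\epsilon)$-optimal subgraph, i.e. for which $\Phi(G_i,\beta)\ge(1-\epsilon)\Phi(G_{opt},\beta)$. Then $$\mathbb{E}[X]=\Omega\!\left(\frac{\sum_{i=1}^k|V(G_i)|}{|V(G)|}\right),$$ that is, there is an absolute constant $c>0$ such that $\mathbb{E}[X]\ge c\,\sum_{i=1}^k|V(G_i)|/|V(G)|$ for the subgraphs $G_1,\dots,G_k$ found, whatever the outcome of the sampling.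
   Context: A signed graph is a finite undirected simple graph $G=(V,E^+,E^-)$ whose edge set is partitioned into positive edges $E^+$ and negative edges $E^-$. A signed graph is balanced if it is connected and its vertex set splits as $V=V_1\cup V_2$, $V_1\cap V_2=\emptyset$, such that each positive edge has both ends in the same part and each negative edge has its ends in different parts. The frustration index $L(G)$ is the minimum number of edges whose deletion makes all connected components of $G$ balanced. For $\beta\in(0,1]$, the Tolerant Balance Index is $\Phi(G,\beta)=|E^+\cup E^-|-\frac{L(G)}{\beta}$. For a coloring $\mathcal{X}=(x_i)_{i\in V}\in\{0,1\}^V$, the Tolerant Balance Count is $$\hat\Phi(G,\beta,\mathcal{X})=|E^+\cup E^-|-\frac1\beta\sum_{(i,j)\in E^+}\mathbf 1\{x_i\ne x_j\}-\frac1\beta\sum_{(i,j)\in E^-}\mathbf 1\{x_i=x_j\}.$$ Algorithm $\mathtt{Search}(G,\beta,s,p,T)$, with fixed parameters $p\in(0,1)$ and $T$ a positive integer, started from $s\in V$. It maintains a set $S$ of colored vertices (pairs $(x,c)$, $x\in V$, $c\in\{0,1\}$, each vertex occurring at most once). The value of $S$ is $\hat\Phi$ of the subgraph induced by the vertices of $S$ with the coloring stored in $S$. The gain of an operation is the change it causes in this value. The operations are: VertexInsert$(x,c)$ (add $(x,c)$ to $S$, for $x\notin S$ adjacent to $S$), VertexDelete$(x)$ (remove $x$ from $S$, the remaining induced subgraph being required to stay connected), ColorFlip$(x)$ (replace the color of $x\in S$ by the opposite one). Initially $S=\{(s,0)\}$, $\hat\Phi_{opt}=\hat\Phi_{cur}=0$,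 and a counter $\tau=T$. While $\tau\ge 0$ and $|S|<|V|$, do one iteration: let $op$ be the maximum-gain insertion; with probability $p$, replace $op$ by the maximum-gain color flip if it has larger gain; independently, with probability $\frac{p\log|S|}{|S|}$, replace $op$ by the maximum-gain deletion keeping the subgraph connected if it has larger gain; execute $op$ and add its gain to $\hat\Phi_{cur}$; if $\hat\Phi_{cur}\le\hat\Phi_{opt}$ set $\tau\leftarrow\tau-1$, otherwise set $\hat\Phi_{opt}\leftarrow\hat\Phi_{cur}$ and $\tau\leftarrow\tau+T$. After the loop, the operations executed since the last update of $\hat\Phi_{opt}$ are undone; the subgraph of $G$ induced by $S$ and the coloring stored in $S$ are the subgraph and coloring found. The outcome $(G_x,\mathcal{X}_x)$ of the search from each starting vertex $x$ is regarded as fixed, so the only randomness in the statement is the sampling of $x_1,\dots,x_k$. *)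

(* Defs.v *)
From HB Require Import structures.
From mathcomp Require Import all_boot all_order all_algebra.
From mathcomp Require Import all_classical all_reals all_analysis.
(* The names shared with classical_sets (set0, setU0, ...) denote finite sets. *)
From mathcomp Require Import finset.

Set Implicit Arguments.
Unset Strict Implicit.
Unset Printing Implicit Defensive.

Import Order.TTheory GRing.Theory Num.Theory.

Local Open Scope ring_scope.

(* An edge is the two-element set of its ends, so the graphs below are
   undirected and have neither loops nor multiple edges. *)
Record sgraph (V : finType) := SGraph {
  pos_edges : {set {set V}};
  neg_edges : {set {set V}};
  pos_card2 : forall e, e \in pos_edges -> #|e| = 2%N;
  neg_card2 : forall e, e \in neg_edges -> #|e| = 2%N;
  pos_neg_disjoint : [disjoint pos_edges & neg_edges] }.

Section SignedGraph.
Variable V : finType.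
Implicit Types (G : sgraph V) (S : {set V}) (F : {set {set V}}).

Definition edges G : {set {set V}} := pos_edges G :|: neg_edges G.

Definition adjacent G : rel V := fun x y => [set x; y] \in edges G.

Definition connected G : bool := [forall x, forall y, connect (adjacent G) x y].

Definition balanced G : bool :=
  connected G &&
  [exists V1 : {set V}, exists V2 : {set V},
    [&& V1 :|: V2 == [set: V], V1 :&: V2 == set0,
        [forall e in pos_edges G, (e \subset V1) || (e \subset V2)] &
        [forall e in neg_edges G, (e :&: V1 != set0) && (e :&: V2 != set0)]]].

Fact delete_pos2 G F e : e \in pos_edges G :\: F -> #|e| = 2%N.
Proof. by case/setDP => /pos_card2. Qed.

Fact delete_neg2 G F e : e \in neg_edges G :\: F -> #|e| = 2%N.
Proof. by case/setDP => /neg_card2. Qed.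

Fact delete_disjoint G F : [disjoint pos_edges G :\: F & neg_edges G :\: F].
Proof.
apply: disjointWl (subsetDl _ _) _.
exact: disjointWr (subsetDl _ _) (pos_neg_disjoint G).
Qed.

Definition delete_edges G F : sgraph V :=
  SGraph (@delete_pos2 G F) (@delete_neg2 G F) (delete_disjoint G F).

Definition induced_edges S (E : {set {set V}}) : {set {set {x : V | x \in S}}} :=
  [set e : {set {x : V | x \in S}} | val @: e \in E].

Fact induced_card2 S (E : {set {set V}}) :
  (forall e, e \in E -> #|e| = 2%N) ->
  forall e, e \in induced_edges S E -> #|e| = 2%N.
Proof. by move=> E2 e; rewrite inE => /E2; rewrite card_imset //; exact: val_inj. Qed.

Fact induced_disjoint G S :
  [disjoint induced_edges S (pos_edges G) & induced_edges S (neg_edges G)].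
Proof.
rewrite -setI_eq0 -subset0; apply/fintype.subsetP => e; rewrite !inE => /andP[ep en].
by have /pred0P/(_ (val @: e)) := pos_neg_disjoint G; rewrite /= ep en.
Qed.

Definition induced G S : sgraph {x : V | x \in S} :=
  SGraph (@induced_card2 S _ (@pos_card2 _ G)) (@induced_card2 S _ (@neg_card2 _ G))
         (induced_disjoint G S).

Definition component G (x : V) : {set V} := [set y | connect (adjacent G) x y].

End SignedGraph.

Section Frustration.
Variable V : finType.
Implicit Types (G : sgraph V) (F : {set {set V}}).

Definition components_balanced G : bool :=
  [forall x, balanced (induced G (component G x))].

Definition balanced_by_deleting G (n : nat) : bool :=
  [exists F : {set {set V}},
    [&& F \subset edges G, components_balanced (delete_edges G F) & #|F| == n]].

Fact balanced_by_deleting_ex G : exists n, balanced_by_deleting G n.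
Proof.
exists #|edges G|; apply/existsP; exists (edges G); rewrite subxx eqxx andbT /=.
have E0 : edges (delete_edges G (edges G)) = set0.
  by rewrite /edges /= -setDUl setDv.
move: (delete_edges _ _) E0 => H E0.
have P0 : pos_edges H = set0 by apply/eqP; rewrite -subset0 -E0 subsetUl.
have N0 : neg_edges H = set0 by apply/eqP; rewrite -subset0 -E0 subsetUr.
have cH x y : connect (adjacent H) x y -> x = y.
  by case/connectP => [[|z s] //= /andP[]]; rewrite /adjacent E0 inE.
apply/forallP => x; apply/andP; split.
  apply/forallP => u; apply/forallP => v.
  suff -> : u = v by exact: connect0.
  apply: val_inj; have := valP u; have := valP v.
  by rewrite !inE => /cH <- /cH <-.
apply/existsP; exists setT; apply/existsP; exists set0.
rewrite setU0 setI0 !eqxx /=; apply/andP; split; apply/forall_inP => e.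
  by rewrite subsetT.
by rewrite inE N0 inE.
Qed.

Definition frustration_index G : nat := ex_minn (balanced_by_deleting_ex G).

End Frustration.

Section ToleranceIndex.
Variables (R : realType) (V : finType).
Implicit Types (G : sgraph V) (beta : R) (X : V -> bool).

(* Phi(G, beta) *)
Definition tolerant_index G beta : R :=
  #|edges G|%:R - (frustration_index G)%:R / beta.

Definition bichromatic X (e : {set V}) : bool :=
  [exists i in e, exists j in e, X i != X j].

(* \hat\Phi(G, beta, X) *)
Definition tolerant_count G beta X : R :=
  #|edges G|%:R
  - beta^-1 * (\sum_(e in pos_edges G) (bichromatic X e)%:R)
  - beta^-1 * (\sum_(e in neg_edges G) (~~ bichromatic X e)%:R).

End ToleranceIndex.

(* The set of pairs (x, c) held by Search, each vertex occurring at most once: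
   [S x = Some c] when (x, c) belongs to it. *)
Notation colored_set V := {ffun V -> option bool}.

Inductive operation (V : finType) : Type :=
  | VertexInsert of V & bool
  | VertexDelete of V
  | ColorFlip of V.

Section Search.
Variables (R : realType) (V : finType) (G : sgraph V) (beta p : R) (T : nat).
Implicit Types (S : colored_set V) (op : operation V).

Definition vertices S : {set V} := [set x | isSome (S x)].

Definition subgraph S : sgraph {x : V | x \in vertices S} := induced G (vertices S).

(* The default [false] is never used, as [S] is defined on its vertices. *)
Definition coloring S (x : {x : V | x \in vertices S}) : bool :=
  odflt false (S (val x)).

Definition value S : R := tolerant_count (subgraph S) beta (@coloring S).

Definition execute op S : colored_set V :=
  match op with
  | VertexInsert x c => [ffun y => if y == x then Some c else S y]
  | VertexDelete x => [ffun y => if y == x then None else S y]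
  | ColorFlip x => [ffun y => if y == x then omap negb (S y) else S y]
  end.

Definition gain S op : R := value (execute op S) - value S.

Definition insertion S op : Prop :=
  exists x c, [/\ op = VertexInsert x c, x \notin vertices S
                & exists2 y, y \in vertices S & adjacent G x y].

Definition flip S op : Prop := exists2 x, op = ColorFlip x & x \in vertices S.

Definition deletion S op : Prop :=
  exists x, [/\ op = VertexDelete x, x \in vertices S
              & connected (induced G (vertices (execute op S)))].

(* Maximum gain among the operations satisfying [C], ties being broken
   arbitrarily; [None] when there is no such operation. *)
Definition max_gain S (C : operation V -> Prop) (o : option (operation V)) : Prop :=
  match o with
  | Some op => C op /\ forall op', C op' -> gain S op' <= gain S op
  | None => forall op, ~ C op
  end.

(* A missing operation has gain -oo. *)
Definition larger_gain S (o o' : option (operation V)) : bool :=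
  match o, o' with
  | None, _ => false
  | Some _, None => true
  | Some op, Some op' => gain S op' < gain S op
  end.

(* [b] is the result, of positive probability, of a coin that shows [true]
   with probability [q]. *)
Definition coin_result (q : R) (b : bool) : Prop := if b then 0 < q else q < 1.

Definition replacement S (C : operation V -> Prop) (b : bool)
    (o o' : option (operation V)) : Prop :=
  if b then exists2 m, max_gain S C m & o' = if larger_gain S m o then m else o
  else o' = o.

Definition chosen_operation S (o : option (operation V)) : Prop :=
  exists (b1 b2 : bool) (o1 o2 : option (operation V)),
    [/\ coin_result p b1,
        coin_result (p * ln #|vertices S|%:R / #|vertices S|%:R) b2,
        max_gain S (insertion S) o1,
        replacement S (flip S) b1 o1 o2
      & replacement S (deletion S) b2 o2 o].

(* [saved] is the set held at the last update of [phi_opt]; undoing the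
   operations executed since then restores it. *)
Record search_state := SearchState {
  current : colored_set V;
  saved : colored_set V;
  phi_cur : R;
  phi_opt : R;
  counter : int }.

Definition initial_set (s : V) : colored_set V :=
  [ffun y => if y == s then Some false else None].

Definition initial_state (s : V) : search_state :=
  SearchState (initial_set s) (initial_set s) 0 0 T%:Z.

Definition running (st : search_state) : bool :=
  (0 <= counter st) && (#|vertices (current st)| < #|V|)%N.

(* When no operation is available the iteration leaves the set unchanged,
   with gain 0. *)
Definition next_state (st : search_state) (o : option (operation V)) : search_state :=
  let S := if o is Some op then execute op (current st) else current st in
  let cur := phi_cur st + (if o is Some op then gain (current st) op else 0) in
  if cur <= phi_opt st
  then SearchState S (saved st) cur (phi_opt st) (counter st - 1)
  else SearchState S S cur cur (counter st + T%:Z).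

Inductive search_from : search_state -> colored_set V -> Prop :=
  | search_stop st : ~~ running st -> search_from st (saved st)
  | search_iter st o out :
      running st -> chosen_operation (current st) o ->
      search_from (next_state st o) out -> search_from st out.

(* [S] is a possible outcome of Search(G, beta, s, p, T). *)
Definition search_outcome (s : V) (S : colored_set V) : Prop :=
  search_from (initial_state s) S.

End Search.

Section Sampling.
Variables (R : realType) (d : measure_display) (Omega : measurableType d).
Variables (P : probability Omega R) (V : finType) (k : nat).
Implicit Types (x : 'I_k -> Omega -> V).

(* [V] carries the discrete sigma-algebra. *)
Definition sample_event x (i : 'I_k) (A : {set V}) : set Omega :=
  [set w | x i w \in A]%classic.

Definition samples_measurable x : Prop :=
  forall i A, measurable (sample_event x i A).

Definition samples_uniform x : Prop :=
  forall i v, P (sample_event x i [set v]) = (#|V|%:R^-1)%:E.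

Definition samples_independent x : Prop :=
  forall (J : {set 'I_k}) (A : 'I_k -> {set V}),
    P [set w | forall i, i \in J -> x i w \in A i]%classic
    = (\prod_(i in J) P (sample_event x i (A i)))%E.

End Sampling.

Section Optimality.
Variables (R : realType) (V : finType) (G : sgraph V) (beta eps : R).
(* [found x] encodes the pair (G_x, X_x), and [opt] is a vertex such that
   G_opt is G_x for x = opt. *)
Variables (found : V -> colored_set V) (opt : V).

Definition found_index (x : V) : R := tolerant_index (subgraph G (found x)) beta.

Definition found_count (x : V) : R := value G beta (found x).

Definition optimal_start : Prop := forall x, found_count x <= found_count opt.

Definition near_optimal (x : V) : bool :=
  (1 - eps) * found_index opt <= found_index x.

Definition hypothesis_A : Prop :=
  exists V' : {set V},
    [/\ V' \subset vertices (found opt),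
        2^-1 <= #|V'|%:R / #|vertices (found opt)|%:R :> R
      & forall x, x \in V' -> near_optimal x].

Definition hypothesis_B : Prop :=
  forall a b, found_count b <= found_count a ->
    (#|vertices (found b)| <= 2 * #|vertices (found a)|)%N.

(* X, the number of iterations that find a (1 - eps)-optimal subgraph *)
Definition successes (Omega : Type) (k : nat) (x : 'I_k -> Omega -> V) (w : Omega) : R :=
  #|[set i : 'I_k | near_optimal (x i w)]|%:R.

End Optimality.

(* Main.v *)
Require Import Defs.
From HB Require Import structures.
From mathcomp Require Import all_boot all_order all_algebra.
From mathcomp Require Import all_classical all_reals all_analysis.
From mathcomp Require Import measurable_realfun.

Import Order.TTheory GRing.Theory Num.Theory.
Local Open Scope ring_scope.

(** By linearity E[X] = k |N| / |V|, where N is the set of near-optimal starting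
    vertices. Hypothesis A gives |V(G_opt)| <= 2 |V'| <= 2 |N|, and Hypothesis B,
    applied to the optimal start, gives |V(G_i)| <= 2 |V(G_opt)| <= 4 |N|; hence
    the constant 1/4. *)

(** Indicators are nonnegative and measurable, so the integral commutes with the finite sum. The
    index is a sequence so that the lemma serves sums over vertices as well as over iterations. *)
Lemma expectation_sum_indic (R : realType) (d : measure_display)
    (Omega : measurableType d) (P : probability Omega R) (I : Type) (s : seq I)
    (E : I -> set Omega) (mE : forall i, measurable (E i)) :
  ('E_P[fun w => (\sum_(i <- s) \1_(E i) w)%R] = \sum_(i <- s) P (E i))%E.
Proof.
rewrite unlock; under eq_integral do rewrite -sumEFin.
rewrite ge0_integral_sum //; first by
  apply: eq_bigr => i _; rewrite integral_indic // setIT.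
by move=> i; apply/measurable_EFinP; exact: measurable_indic.
Qed.

Section UniformSamples.
Variables (R : realType) (d : measure_display) (Omega : measurableType d).
Variables (P : probability Omega R) (V : finType) (k : nat).
Variable x : 'I_k -> Omega -> V.
Hypotheses (mx : samples_measurable x) (ux : samples_uniform P x).

Lemma indic_sample_event (i : 'I_k) (A : {set V}) (w : Omega) :
  \1_(sample_event x i A) w = (x i w \in A)%:R :> R.
Proof. by rewrite indicE mem_setE. Qed.

(** Uniformity is given on singletons only. Additivity extends it to [A], in the form of linearity:
    the indicator of the event is the sum of the indicators of its singleton events. *)
Lemma sample_event_probability (i : 'I_k) (A : {set V}) :
  P (sample_event x i A) = (#|A|%:R / #|V|%:R)%:E.
Proof.
have -> : P (sample_event x i A)
        = (\sum_(v <- enum A) P (sample_event x i [set v]%SET))%E.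
  rewrite -expectation_sum_indic // -expectation_indic //.
  congr expectation; apply/funext => w.
  rewrite big_enum /= indic_sample_event.
  under eq_bigr do rewrite indic_sample_event finset.in_set1.
  (* At most one term of the sum is nonzero, the one with [v = x i w]. *)
  have [xA|xA] := boolP (x i w \in A).
    by rewrite (bigD1 _ xA) /= eqxx big1 ?addr0 // => v /andP[_]; rewrite eq_sym => /negbTE->.
  by rewrite big1 // => v vA; case: eqP xA => // ->; rewrite vA.
under eq_bigr do rewrite ux.
by rewrite sumEFin big_enum /= sumr_const mulr_natl.
Qed.

(** The number of hits is a sum of [k] indicators, each of expectation [#|A| / #|V|]. *)
Lemma expected_hits (A : {set V}) :
  ('E_P[fun w => #|[set i | x i w \in A]%SET|%:R]
   = (k%:R * (#|A|%:R / #|V|%:R))%:E)%E.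
Proof.
have -> : (fun w => #|[set i | x i w \in A]%SET|%:R)
        = (fun w => \sum_(i <- enum 'I_k) \1_(sample_event x i A) w) :> (_ -> R).
  apply/funext => w; rewrite big_enum /= -sum1_card natr_sum big_mkcond /=.
  by apply: eq_bigr => i _; rewrite finset.inE indic_sample_event; case: ifP.
rewrite expectation_sum_indic //.
under eq_bigr do rewrite sample_event_probability.
by rewrite sumEFin big_enum /= sumr_const card_ord -(mulr_natl (_ / _)).
Qed.

End UniformSamples.

Theorem lemma4p3 (R : realType) :
  exists c : R, 0 < c /\
  forall (V : finType) (G : sgraph V) (beta eps p : R) (T : nat)
    (found : V -> colored_set V) (opt : V)
    (d : measure_display) (Omega : measurableType d) (P : probability Omega R)
    (k : nat) (x : 'I_k -> Omega -> V),
    0 < beta <= 1 -> 0 < eps < 1 -> 0 < p < 1 -> (0 < T)%N ->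
    (forall s, search_outcome G beta p T s (found s)) ->
    optimal_start G beta found opt ->
    hypothesis_A G beta eps found opt ->
    hypothesis_B G beta found ->
    samples_measurable x -> samples_uniform P x -> samples_independent P x ->
    forall w : Omega,
      ((c * ((\sum_(i < k) #|vertices (found (x i w))|%:R) / #|V|%:R))%:E
        <= 'E_P[successes G beta eps found opt x])%E.
Proof.
exists 4^-1; split; first by rewrite invr_gt0 ltr0n.
move=> V G beta eps p T found opt d Omega P k x _ _ _ _ _ hopt.
move=> [V' [_ hV' nearV']] hB mx ux _ w.
pose N := [set v | near_optimal G beta eps found opt v]%SET.
have -> : successes G beta eps found opt x
        = (fun w => #|[set i | x i w \in N]%SET|%:R).
  by apply/funext => u; congr (_%:R); apply: eq_card => i; rewrite !finset.inE.
rewrite (expected_hits _ _ _ _ _ _ _ mx ux) lee_fin.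
(* Division by zero yields 0, so an empty optimal subgraph would contradict the ratio bound [hV'].
   Positivity allows clearing that denominator below. *)
have opt_gt0 : (0 < #|vertices (found opt)|)%N.
  rewrite lt0n; apply: contraTneq hV' => ->.
  by rewrite invr0 mulr0 -ltNge invr_gt0 ltr0n.
have optN : (#|vertices (found opt)| <= 2 * #|N|)%N.
  apply: (@leq_trans (2 * #|V'|)).
    by rewrite -(ler_nat R) natrM -ler_pdivrMl ?ltr0n // -ler_pdivlMr ?ltr0n.
  by rewrite leq_mul2l; apply/subset_leq_card/fintype.subsetP => v /nearV'; rewrite finset.inE.
(* With the common factor [#|V|^-1] removed, it remains to bound the sum of the sizes found by
   [4 * (k * #|N|)]. Writing this bound as a sum of [k] terms [4 * #|N|] allows a termwise
   comparison, valid for every outcome [w]. *)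
rewrite !mulrA ler_wpM2r ?invr_ge0 ?ler0n // ler_pdivrMl ?ltr0n //.
rewrite -natr_sum -!natrM ler_nat mulnCA -[k in leqRHS]card_ord -sum_nat_const.
apply: leq_sum => i _; apply: leq_trans (hB _ _ (hopt _)) _.
by rewrite -[4%N]/(2 * 2)%N -mulnA leq_mul2l. 
Qed.
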